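(* Let $G$ be a group, and suppose that $G$ has a faithful micro-supported action on (the underlying infinite set $\Omega$ of) a Hausdorff topological space $(\Omega;\tau)$. Let $r\geq 1$ and let $w=w(x_1,\dots,x_r)\in G*F_r$ be a regular word with constants in $G$. Then the set $$\{(g_1,\dots,g_r)\in G^r \mid w(g_1,\dots,g_r)\neq 1\}$$ is dense in $G^r$ with respect to the (product of the) topology of pointwise convergence on $G$ induced by the action on $\Omega$ considered as a discrete set. In particular, every mixed identity of $G$ is singular.
   Context: Words. $F_r$ is the free group on generators $x_1,\dots,x_r$. A word with constants in $G$ in $r$ variables is an element $w$ of the free product $G*F_r$. For $(g_1,\dots,g_r)\in G^r$, $w(g_1,\dots,g_r)\in G$ is the image of $w$ under the homomorphism $G*F_r\to G$ which is the identity on $G$ and sends $x_i$ to $g_i$. The word $w$ is a mixed identity of $G$ if $w(g_1,\dots,g_r)=1$ for all $(g_1,\dots,g_r)\in G^r$. Let $\mathrm{rk}\colon G*F_r\to F_r$ be the homomorphism sending every element of $G$ to $1$ and fixing $F_r$ pointwise. The word $w$ is singular if $\mathrm{rk}(w)=1$, and regular otherwise. Micro-supported actions. Let $G$ act on $\Omega$ by homeomorphisms of the Hausdorff space $(\Omega;\tau)$. For $A\subseteq \Omega$, $G_A$ is the pointwise stabiliser of $A$ in $G$. The action is micro-supported if $G_{\Omega\setminus U}\neq\{1\}$ for every non-empty open set $U\subseteq\Omega$. Topology on $G$. The topology of pointwise convergence on $G$ has as a basis the sets $\{h\in G\mid h(\bar b)=\bar b'\}$, where $\bar b,\bar b'$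 are finite tuples of elements of $\Omega$ of the same length (so $\Omega$ is here regarded as discrete, ignoring $\tau$); $G^r$ carries the product topology. *)

(* Defs.v *)
From HB Require Import structures.
From mathcomp Require Import all_boot.
From mathcomp Require Import boolp classical_sets functions cardinality.
From mathcomp Require Import topology.

Set Implicit Arguments.
Unset Strict Implicit.
Unset Printing Implicit Defensive.

Local Open Scope classical_set_scope.
Local Open Scope group_scope.
Local Open Scope quotient_scope.

(* In a word over X, the letter (x, false) stands for x and (x, true) for its *)
(* formal inverse.                                                            *)
Definition group_word (X : Type) : Type := {classic seq (X * bool)}.

HB.instance Definition _ (X : Type) := Choice.on (group_word X).

Section Presentation.
Variables (X : Type) (R : seq (X * bool) -> seq (X * bool) -> Prop).

Definition inv_letter (a : X * bool) := (a.1, ~~ a.2).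
Definition inv_word (u : seq (X * bool)) := rev (map inv_letter u).

Inductive word_cong : seq (X * bool) -> seq (X * bool) -> Prop :=
| word_cong_refl u : word_cong u u
| word_cong_sym u v : word_cong u v -> word_cong v u
| word_cong_trans u v t : word_cong u v -> word_cong v t -> word_cong u t
| word_cong_cat u u' v v' :
    word_cong u u' -> word_cong v v' -> word_cong (u ++ v) (u' ++ v')
| word_cong_cancel a : word_cong [:: a; inv_letter a] [::]
| word_cong_relation u v : R u v -> word_cong u v.

Definition word_equiv : rel (group_word X) := fun u v => `[< word_cong u v >].

Lemma word_equiv_is_equiv : equiv_class_of word_equiv.
Proof.
split=> [u|u v|v u t].
- exact/asboolP/word_cong_refl.
- by apply/asboolP/asboolP => /word_cong_sym.
- move=> /asboolP uv /asboolP vt; apply/asboolP; exact: word_cong_trans uv vt.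
Qed.

Canonical word_equiv_equiv := EquivRelPack word_equiv_is_equiv.

(* The group < X | u = v for all u, v such that R u v >. *)
Definition presented : Type := {eq_quot word_equiv}.

HB.instance Definition _ := Choice.on presented.

Definition presented_class (u : seq (X * bool)) : presented :=
  \pi_{eq_quot word_equiv} (u : group_word X).

Definition presented_repr (p : presented) : seq (X * bool) :=
  repr (p : {eq_quot word_equiv}).

Lemma presented_reprK : cancel presented_repr presented_class.
Proof. by move=> p; rewrite /presented_class /presented_repr reprK. Qed.

Lemma presented_classP u v : presented_class u = presented_class v <-> word_cong u v.
Proof.
split=> [/eqmodP/asboolP //|uv].
exact/eqmodP/asboolP.
Qed.

Lemma presented_repr_cong u : word_cong (presented_repr (presented_class u)) u.
Proof. by apply/presented_classP; rewrite presented_reprK. Qed.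

Definition presented_mul (p q : presented) : presented :=
  presented_class (presented_repr p ++ presented_repr q).
Definition presented_one : presented := presented_class [::].
Definition presented_inv (p : presented) : presented :=
  presented_class (inv_word (presented_repr p)).

Lemma presented_class_cat u v :
  presented_mul (presented_class u) (presented_class v) = presented_class (u ++ v).
Proof.
by apply/presented_classP; apply: word_cong_cat; exact: presented_repr_cong.
Qed.

Lemma inv_wordK : involutive inv_word.
Proof.
move=> u; rewrite /inv_word map_rev revK -map_comp -[RHS]map_id.
by apply: eq_map => -[x b]; rewrite /= /inv_letter /= negbK.
Qed.

Lemma word_cong_catV u : word_cong (u ++ inv_word u) [::].
Proof.
elim: u => [|a u IH]; first exact: word_cong_refl.
rewrite /inv_word /= rev_cons -cats1 -cat1s catA -catA.
apply: word_cong_trans (word_cong_cancel a).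
rewrite -[X in word_cong _ X]/([:: a] ++ [:: inv_letter a]).
apply: word_cong_cat; first exact: word_cong_refl.
rewrite catA -[X in word_cong _ X]/([::] ++ [:: inv_letter a]).
by apply: word_cong_cat => //; exact: word_cong_refl.
Qed.

Lemma presented_mulA : associative presented_mul.
Proof.
move=> p q s; rewrite -(presented_reprK p) -(presented_reprK q).
by rewrite -(presented_reprK s) !presented_class_cat catA.
Qed.

Lemma presented_mul1 : left_id presented_one presented_mul.
Proof. by move=> p; rewrite -(presented_reprK p) presented_class_cat. Qed.

Lemma presented_mulr1 : right_id presented_one presented_mul.
Proof. by move=> p; rewrite -(presented_reprK p) presented_class_cat cats0. Qed.

Lemma presented_mulV : right_inverse presented_one presented_inv presented_mul.
Proof.
move=> p; rewrite /presented_inv -{1}(presented_reprK p) presented_class_cat.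
exact/presented_classP/word_cong_catV.
Qed.

Lemma presented_mulVl : left_inverse presented_one presented_inv presented_mul.
Proof.
move=> p; rewrite /presented_inv -{2}(presented_reprK p) presented_class_cat.
apply/presented_classP; rewrite -{2}(inv_wordK (presented_repr p)).
exact: word_cong_catV.
Qed.

HB.instance Definition _ := isGroup.Build presented
  presented_mulA presented_mul1 presented_mulr1 presented_mulVl presented_mulV.

Definition presented_gen (x : X) : presented := presented_class [:: (x, false)].

Lemma presented_classM u v :
  presented_class (u ++ v) = presented_class u * presented_class v.
Proof. by rewrite -presented_class_cat. Qed.

Lemma presented_class1 : presented_class [::] = 1.
Proof. by []. Qed.

Lemma presented_gen_inv x : presented_class [:: (x, true)] = (presented_gen x)^-1.
Proof.
apply: (@mulgI _ (presented_gen x)); rewrite mulgV -presented_classM.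
exact/presented_classP/(word_cong_cancel (x, false)).
Qed.

End Presentation.

Section WordValue.
Variables (X : Type) (K : groupType) (f : X -> K).

Definition word_value (u : seq (X * bool)) : K :=
  foldr (fun a k => (if a.2 then (f a.1)^-1 else f a.1) * k) 1 u.

Lemma word_value_cat u v : word_value (u ++ v) = word_value u * word_value v.
Proof. by elim: u => [|a u IH] /=; rewrite ?mul1g // IH mulgA. Qed.

Lemma word_value_cong R u v :
  (forall s t, R s t -> word_value s = word_value t) ->
  word_cong R u v -> word_value u = word_value v.
Proof.
move=> HR; elim=> {u v} [//|u v _ -> //|u v t _ -> _ -> //|||].
- by move=> u u' v v' _ e _ e'; rewrite !word_value_cat e e'.
- by case=> x [] /=; rewrite mulg1 ?mulVg ?mulgV.
- by move=> u v /HR.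
Qed.

(* This is a homomorphism, namely the one extending f, only when the values   *)
(* of f satisfy the relations R.                                              *)
Definition presented_lift (R : seq (X * bool) -> seq (X * bool) -> Prop)
  (p : presented R) : K := word_value (presented_repr p).

Lemma presented_lift_class R u :
  (forall s t, R s t -> word_value s = word_value t) ->
  presented_lift (presented_class R u) = word_value u.
Proof. by move=> HR; apply: (word_value_cong HR); exact: presented_repr_cong. Qed.

Lemma presented_liftM R :
  (forall s t, R s t -> word_value s = word_value t) ->
  {morph @presented_lift R : p q / p * q}.
Proof.
move=> HR p q; rewrite -(presented_reprK p) -(presented_reprK q).
by rewrite -presented_classM !presented_lift_class // word_value_cat.
Qed.

Lemma presented_lift_gen R x :
  (forall s t, R s t -> word_value s = word_value t) ->
  presented_lift (presented_gen R x) = f x.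
Proof. by move=> HR; rewrite presented_lift_class //= mulg1. Qed.

Lemma presented_lift_unique R (h : {multiplicative presented R -> K}) :
  (forall x, h (presented_gen R x) = f x) -> forall p, h p = presented_lift p.
Proof.
move=> hf p; rewrite -{1}(presented_reprK p) /presented_lift.
have h1 : h 1 = 1.
  by apply: (@mulgI _ (h 1)); rewrite -gmulfM !mulg1.
have hV q : h q^-1 = (h q)^-1.
  by apply: (@mulgI _ (h q)); rewrite -gmulfM !mulgV.
elim: (presented_repr p) => [|[x b] u IH] /=; first by rewrite presented_class1.
rewrite -cat1s presented_classM gmulfM IH; congr (_ * _).
by case: b; rewrite ?presented_gen_inv ?hV -hf.
Qed.

End WordValue.

Section FreeGroup.
Variable X : Type.

Definition no_relation (_ _ : seq (X * bool)) : Prop := False.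

Definition free_group : Type := presented no_relation.
HB.instance Definition _ := Group.on free_group.

Definition free_gen (x : X) : free_group := presented_gen no_relation x.

Definition free_lift (K : groupType) (f : X -> K) (p : free_group) : K :=
  presented_lift f p.

Lemma free_liftM (K : groupType) (f : X -> K) :
  {morph free_lift f : p q / p * q}.
Proof. exact: presented_liftM. Qed.

HB.instance Definition _ (K : groupType) (f : X -> K) :=
  isMultiplicative.Build free_group K (free_lift f) (free_liftM f).

Lemma free_lift_gen (K : groupType) (f : X -> K) x : free_lift f (free_gen x) = f x.
Proof. exact: presented_lift_gen. Qed.

Lemma free_lift_unique (K : groupType) (f : X -> K)
    (h : {multiplicative free_group -> K}) :
  (forall x, h (free_gen x) = f x) -> h =1 free_lift f.
Proof. exact: presented_lift_unique. Qed.

End FreeGroup.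

Section FreeProduct.
Variables G H : groupType.

(* The multiplication tables of G and H; these already force the copies of    *)
(* 1 in G and of 1 in H to be trivial, and inverses to agree.                 *)
Inductive free_prod_relation :
    seq ((G + H) * bool) -> seq ((G + H) * bool) -> Prop :=
| free_prod_relation_l g g' : free_prod_relation
    [:: (inl g, false); (inl g', false)] [:: (inl (g * g'), false)]
| free_prod_relation_r h h' : free_prod_relation
    [:: (inr h, false); (inr h', false)] [:: (inr (h * h'), false)].

Definition free_prod : Type := presented free_prod_relation.
HB.instance Definition _ := Group.on free_prod.

Definition free_prod_inl (g : G) : free_prod :=
  presented_gen free_prod_relation (inl g).
Definition free_prod_inr (h : H) : free_prod :=
  presented_gen free_prod_relation (inr h).

Lemma free_prod_inlM : {morph free_prod_inl : x y / x * y}.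
Proof.
move=> g g'; rewrite /free_prod_inl /presented_gen -presented_classM.
by apply/esym/presented_classP/word_cong_relation/free_prod_relation_l.
Qed.

Lemma free_prod_inrM : {morph free_prod_inr : x y / x * y}.
Proof.
move=> h h'; rewrite /free_prod_inr /presented_gen -presented_classM.
by apply/esym/presented_classP/word_cong_relation/free_prod_relation_r.
Qed.

HB.instance Definition _ :=
  isMultiplicative.Build G free_prod free_prod_inl free_prod_inlM.
HB.instance Definition _ :=
  isMultiplicative.Build H free_prod free_prod_inr free_prod_inrM.

Section Lift.
Variables (K : groupType) (f : {multiplicative G -> K}) (h : {multiplicative H -> K}).

Definition free_prod_lift (p : free_prod) : K :=
  presented_lift (fun x => match x with inl a => f a | inr b => h b end) p.

Lemma free_prod_lift_relation s t : free_prod_relation s t ->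
  let F x := match x with inl a => f a | inr b => h b end in
  word_value F s = word_value F t.
Proof. by case=> x y /=; rewrite !mulg1 gmulfM. Qed.

Lemma free_prod_liftM : {morph free_prod_lift : p q / p * q}.
Proof. exact: presented_liftM free_prod_lift_relation. Qed.

HB.instance Definition _ :=
  isMultiplicative.Build free_prod K free_prod_lift free_prod_liftM.

Lemma free_prod_lift_inl g : free_prod_lift (free_prod_inl g) = f g.
Proof. exact: presented_lift_gen free_prod_lift_relation. Qed.

Lemma free_prod_lift_inr x : free_prod_lift (free_prod_inr x) = h x.
Proof. exact: presented_lift_gen free_prod_lift_relation. Qed.

Lemma free_prod_lift_unique (k : {multiplicative free_prod -> K}) :
  (forall g, k (free_prod_inl g) = f g) ->
  (forall x, k (free_prod_inr x) = h x) -> k =1 free_prod_lift.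
Proof.
move=> kf kh p; apply: presented_lift_unique => -[a|b]; [exact: kf|exact: kh].
Qed.

End Lift.
End FreeProduct.

Section TrivialMorphism.
Variables G K : groupType.

Definition trivial_morph (_ : G) : K := 1.

Lemma trivial_morphM : {morph trivial_morph : x y / x * y}.
Proof. by move=> x y; rewrite /trivial_morph mulg1. Qed.

HB.instance Definition _ := isMultiplicative.Build G K trivial_morph trivial_morphM.
End TrivialMorphism.

Section WordsWithConstants.
Variables (G : groupType) (r : nat).

(* The free product of G with the free group F_r. *)
Definition const_word : Type := free_prod G (free_group 'I_r).
HB.instance Definition _ := Group.on const_word.

Definition word_eval (w : const_word) (g : 'I_r -> G) : G :=
  free_prod_lift (@idfun G) (free_lift g) w.

Definition mixed_identity (w : const_word) : Prop :=
  forall g : 'I_r -> G, word_eval w g = 1.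

Definition word_rk (w : const_word) : free_group 'I_r :=
  free_prod_lift (@trivial_morph G (free_group 'I_r)) (@idfun (free_group 'I_r)) w.

Definition singular (w : const_word) : Prop := word_rk w = 1.
Definition regular (w : const_word) : Prop := ~ singular w.

End WordsWithConstants.

Section Actions.
Variable G : groupType.

Definition is_action (Omega : Type) (act : G -> Omega -> Omega) : Prop :=
  (forall x, act 1 x = x) /\
  (forall g h x, act (g * h) x = act g (act h x)).

Definition faithful_action (Omega : Type) (act : G -> Omega -> Omega) : Prop :=
  forall g, (forall x, act g x = x) -> g = 1.

Definition homeomorphism (S T : topologicalType) (f : S -> T) : Prop :=
  exists f' : T -> S,
    [/\ cancel f f', cancel f' f, continuous f & continuous f'].

Definition acts_by_homeomorphisms (Omega : topologicalType)
    (act : G -> Omega -> Omega) : Prop :=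
  forall g, homeomorphism (act g).

Definition pointwise_stabiliser (Omega : Type) (act : G -> Omega -> Omega)
    (A : set Omega) : set G :=
  [set g | forall x, A x -> act g x = x].

Definition micro_supported (Omega : topologicalType)
    (act : G -> Omega -> Omega) : Prop :=
  forall U : set Omega, open U -> U !=set0 ->
    pointwise_stabiliser act (~` U) <> [set 1].

End Actions.

(* A copy of G, carrying the topology of pointwise convergence of its action  *)
(* on the discrete set Omega; a topology on Omega plays no role here.         *)
Definition ptwise_group (G : groupType) (Omega : Type)
  (act : G -> Omega -> Omega) : Type := G.

Section PointwiseConvergence.
Variables (G : groupType) (Omega : Type) (act : G -> Omega -> Omega).
Local Notation ptwise_group := (ptwise_group act).

HB.instance Definition _ := Group.on ptwise_group.

Definition ptwise_base : set (set ptwise_group) :=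
  [set A | exists n (b b' : n.-tuple Omega),
     A = [set h : ptwise_group | map_tuple (act h) b = b']].

Lemma ptwise_base_cover : \bigcup_(A in ptwise_base) id A = setT.
Proof.
rewrite -subTset => h _; exists setT => //.
exists 0, [tuple], [tuple]; apply/esym; rewrite -subTset => k _ /=.
exact: tuple0.
Qed.

Lemma ptwise_base_join (A B : set ptwise_group) h :
  ptwise_base A -> ptwise_base B -> id A h -> id B h ->
  exists C, [/\ ptwise_base C, id C h & id C `<=` id A `&` id B].
Proof.
move=> [n [b [b' ->]]] [m [c [c' ->]]] /= hb hc.
exists [set k | map_tuple (act k) (cat_tuple b c) = cat_tuple b' c']; split.
- by exists (n + m)%N, (cat_tuple b c), (cat_tuple b' c').
- by apply: val_inj; rewrite /= map_cat -hb -hc.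
- move=> k /(congr1 val) /=; rewrite map_cat => e.
  have sz : size (map (act k) b) = size b' by rewrite size_map !size_tuple.
  split; apply: val_inj => /=.
    by move: (congr1 (take (size b')) e); rewrite take_size_cat // take_size_cat.
  by move: (congr1 (drop (size b')) e); rewrite drop_size_cat // drop_size_cat.
Qed.

HB.instance Definition _ := isBaseTopological.Build ptwise_group
  ptwise_base_cover ptwise_base_join.

End PointwiseConvergence.

(* Main.v *)
(* Fix h in a basic open set given by a finite set B of points, and suppose   *)
(* w(h) = 1. Let L be the values at h of the suffixes of w. By the Hausdorff  *)
(* property there is a non-empty open U, with translates t U (t in L) missing *)
(* B, such that any two elements of L either agree on U or have disjoint      *)
(* translates. Elements k_i of the rigid stabiliser of U can then be spread   *)
(* over these translates, giving k'_i in G that fix B and satisfy             *)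
(* k'_i t = t k_i on U for t in L. Hence w(h k') = w(h) v(k) = v(k) on U with *)
(* v = rk(w), and it suffices that the rigid stabiliser of U satisfies no     *)
(* law. This is Abert's argument: the trajectory of a point under the letters *)
(* of a reduced word can be made injective, one letter at a time.             *)
Require Import Defs.
From HB Require Import structures.
From mathcomp Require Import all_boot.
From mathcomp Require Import boolp classical_sets functions cardinality.
From mathcomp Require Import topology.

Set Implicit Arguments.
Unset Strict Implicit.
Unset Printing Implicit Defensive.

Local Open Scope classical_set_scope.
Local Open Scope group_scope.

(** Two facts combine. Perturbing [h] on small translates of an open set [U] fixes the prescribed
    points and turns a value w(h) = 1 into v(k) on [U], where v spells the rank of w
    ([equal_or_disjoint_translates], [spread_over_translates], [eval_spread]). By regularity v can
    be taken reduced and non-empty, so some k in the rigid stabiliser of [U] makes v(k) non-trivial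
    ([distinct_trajectory], [rist_no_law]). The two meet in [regular_word_nontrivial_value];
    [agree_on_finite_nbhs] turns agreement on finitely many points into density. *)

Section Suffixes.
Variable T : eqType.

(** A word acts letter by letter from the right, so the values of its suffixes carry a point along
    its trajectory. *)
Fixpoint suffixes (s : seq T) : seq (seq T) :=
  s :: (if s is _ :: s' then suffixes s' else [::]).

Lemma suffixes_self s : s \in suffixes s.
Proof. by case: s => [|a s]; rewrite /= inE eqxx. Qed.

Lemma nil_suffixes s : [::] \in suffixes s.
Proof. by elim: s => [|a s IH] //=; rewrite inE IH orbT. Qed.

Lemma suffixes_cons a s t : (t \in suffixes (a :: s)) = (t == a :: s) || (t \in suffixes s).
Proof. by rewrite /= inE. Qed.

Lemma suffixes_tail a s t : a :: s \in suffixes t -> s \in suffixes t.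
Proof.
elim: t => [|b t IH]; rewrite ?suffixes_cons; first by rewrite inE.
by case/orP=> [/eqP[_ ->]|/IH ->]; rewrite ?suffixes_self orbT.
Qed.

Lemma size_suffixes s t : t \in suffixes s -> size t <= size s.
Proof.
elim: s => [|a s IH]; rewrite ?suffixes_cons; first by rewrite inE => /eqP ->.
by case/orP=> [/eqP -> //|/IH/leqW].
Qed.

Lemma cons_notin_suffixes a s : a :: s \notin suffixes s.
Proof. by apply/negP => /size_suffixes; rewrite ltnn. Qed.
End Suffixes.

(** * Reduced words and inverses *)

Section ReducedWords.
Variable X : eqType.
Implicit Types u v : seq (X * bool).

Fixpoint reduced u : bool :=
  if u is a :: u' then (ohead u' != Some (inv_letter a)) && reduced u' else true.

Lemma inv_word_cons (a : X * bool) u : inv_word (a :: u) = inv_word u ++ [:: inv_letter a].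
Proof. by rewrite /inv_word /= rev_cons cats1. Qed.

Lemma exists_reduced R u : exists2 v, reduced v & word_cong R u v.
Proof.
elim: u => [|a u [v rv uv]]; first by exists [::] => //; exact: word_cong_refl.
have auv : word_cong R (a :: u) (a :: v).
  by rewrite -cat1s -[a :: v]cat1s; apply: word_cong_cat => //; exact: word_cong_refl.
have [e|ne] := eqVneq (ohead v) (Some (inv_letter a)); last by exists (a :: v) => //=; rewrite ne.
case: v e rv uv auv => // _ v [->] /= /andP[_ rv] uv auv; exists v => //.
apply: word_cong_trans auv _.
rewrite -[X in word_cong _ _ X]cat0s -[X in word_cong _ X _]/([:: a; inv_letter a] ++ v).
apply: word_cong_cat; [exact: word_cong_cancel|exact: word_cong_refl].
Qed.

Lemma free_group_reduced (p : free_group X) :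
  exists2 v, reduced v & p = presented_class (@no_relation X) v.
Proof.
have [v rv pv] := exists_reduced (@no_relation X) (presented_repr p).
by exists v => //; rewrite -[LHS]presented_reprK; exact/presented_classP.
Qed.
End ReducedWords.

Lemma presented_classV (X : Type) R (u : seq (X * bool)) :
  presented_class R (inv_word u) = (presented_class R u)^-1.
Proof.
apply: (@mulgI _ (presented_class R u)); rewrite mulgV -presented_classM.
exact/presented_classP/word_cong_catV.
Qed.

Section WordValueTheory.
Variables (X : Type) (K : groupType) (f : X -> K).

Lemma word_value_inv u : word_value f (inv_word u) = (word_value f u)^-1.
Proof.
apply: (@mulgI _ (word_value f u)).
rewrite mulgV -word_value_cat.
by rewrite (@word_value_cong _ _ f (@no_relation X) _ [::] _ (word_cong_catV _ _)).
Qed.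
End WordValueTheory.

(** * Spelling words with constants *)

Section ConstantWords.
Variables (G : groupType) (r : nat).
Implicit Type l : seq ((G + 'I_r) * bool).

Definition letter_value (g : 'I_r -> G) (x : G + 'I_r) : G :=
  match x with inl a => a | inr i => g i end.

(** This spells the rank of [l], since [rk] kills the constants. *)
Definition variables l : seq ('I_r * bool) :=
  pmap (fun a => if a.1 is inr i then Some (i, a.2) else None) l.

Lemma variables_cat l l' : variables (l ++ l') = variables l ++ variables l'.
Proof. exact: pmap_cat. Qed.

Definition variable_word (u : seq ('I_r * bool)) : seq ((G + 'I_r) * bool) :=
  map (fun a => (inr a.1, a.2)) u.

Lemma variable_wordK : cancel variable_word variables.
Proof. by elim=> [|[i b] u IH] //=; rewrite IH. Qed.

Lemma variables_inv_word l : variables (inv_word l) = inv_word (variables l).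
Proof.
elim: l => [|[[c|i] b] l IH] //; rewrite inv_word_cons variables_cat IH ?cats0 //.
by rewrite inv_word_cons.
Qed.

(** A generator of the free product coming from the free factor is a whole element of the free
    group; replacing it by a representative word leaves only constants and variables as letters. *)
Lemma const_word_spelling (w : const_word G r) :
  exists l, (forall g, word_eval w g = word_value (letter_value g) l) /\
    word_rk w = presented_class (@no_relation 'I_r) (variables l).
Proof.
rewrite /word_eval /word_rk /free_prod_lift /presented_lift.
elim: (presented_repr w) => [|[x b] u [l [el rl]]] /=; first by exists [::].
suff [l' el' rl'] : exists2 l' : seq ((G + 'I_r) * bool),
    (forall g, match x with inl a => a | inr p => free_lift g p end =
       word_value (letter_value g) l') &
    match x with inl a => 1 | inr p => p end =
       presented_class (@no_relation 'I_r) (variables l').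
  exists ((if b then inv_word l' else l') ++ l); split=> [g|].
    by rewrite word_value_cat -el; case: b; rewrite ?word_value_inv -el'.
  rewrite variables_cat presented_classM -rl; congr (_ * _).
  case: b; last by rewrite -rl'; case: (x).
  by rewrite variables_inv_word presented_classV -rl'; case: (x).
case: x => [c|p]; first by exists [:: (inl c, false)] => // g; rewrite /= mulg1.
exists (variable_word (presented_repr p)) => [g|].
  rewrite /free_lift /presented_lift.
  by elim: (presented_repr p) => [|[i e] v /= ->].
by rewrite variable_wordK presented_reprK.
Qed.
End ConstantWords.

(** * Finitely many hereditary conditions on open sets *)

Lemma locally_forall (S : topologicalType) (I : eqType) (P : I -> set S -> Prop)
    (L : seq I) (y : S) :
  (forall i U V, V `<=` U -> P i U -> P i V) ->
  (forall i, i \in L -> exists U, [/\ open U, U y & P i U]) ->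
  exists U, [/\ open U, U y & forall i, i \in L -> P i U].
Proof.
move=> mono; elim: L => [|i L IH] HL.
  by exists setT; split=> //; exact: openT.
have [|U [oU Uy PU]] := IH; first by move=> j jL; apply: HL; rewrite inE jL orbT.
have [V [oV Vy PV]] := HL i (mem_head _ _).
exists (U `&` V); split=> [|//|j]; first exact: openI.
rewrite inE => /orP[/eqP ->|/PU]; last exact: (mono _ _ _ (@subIsetl _ U V)).
exact: (mono _ _ _ (@subIsetr _ U V)).
Qed.

(** The open set is shrunk once for each index; earlier conditions survive because they are
    hereditary. *)
Lemma densely_forall (S : topologicalType) (I : eqType) (P : I -> set S -> Prop)
    (L : seq I) (U : set S) :
  (forall i U V, V `<=` U -> P i U -> P i V) ->
  (forall i U, open U -> U !=set0 -> exists V, [/\ open V, V !=set0, V `<=` U & P i V]) ->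
  open U -> U !=set0 ->
  exists V, [/\ open V, V !=set0, V `<=` U & forall i, i \in L -> P i V].
Proof.
move=> mono HL oU U0; elim: L => [|i L [V [oV V0 VU PV]]]; first by exists U; split.
have [W [oW W0 WV PW]] := HL i V oV V0.
exists W; split=> //; first exact: subset_trans VU.
by move=> j; rewrite inE => /orP[/eqP ->//|/PV]; exact: (mono _ _ _ WV).
Qed.

(** * Rigid stabilisers and spreading over translates *)

Section Action.
Variables (G : groupType) (Omega : topologicalType) (act : G -> Omega -> Omega).
Hypothesis act_action : is_action act.

Local Notation rist U := (pointwise_stabiliser act (~` U)).

Let act1 x : act 1 x = x. Proof. by case: act_action. Qed.
Let actM g h x : act (g * h) x = act g (act h x). Proof. by case: act_action. Qed.

Lemma actK g : cancel (act g) (act g^-1).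
Proof. by move=> x; rewrite -actM mulVg act1. Qed.

Lemma actVK g : cancel (act g^-1) (act g).
Proof. by move=> x; rewrite -actM mulgV act1. Qed.

Lemma act_inj g : injective (act g).
Proof. exact: can_inj (actK g). Qed.

Lemma ristS U V g : U `<=` V -> rist U g -> rist V g.
Proof. by move=> UV ug x Vx; apply: ug => /UV. Qed.

Lemma ristM U g h : rist U g -> rist U h -> rist U (g * h).
Proof. by move=> ug uh x Ux; rewrite actM uh // ug. Qed.

Lemma ristV U g : rist U g -> rist U g^-1.
Proof. by move=> ug x Ux; apply: (@act_inj g); rewrite actVK ug. Qed.

Lemma rist_stable U g x : rist U g -> U x -> U (act g x).
Proof.
by move=> ug Ux; apply: contrapT => nU; move: (ug _ nU) => /act_inj e; rewrite e in nU.
Qed.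

Lemma rist_word_value (X : Type) U (k : X -> G) u :
  (forall i, rist U (k i)) -> rist U (word_value k u).
Proof.
move=> uk; elim: u => [|[i b] u IH] /=; first by move=> x _; exact: act1.
by apply: ristM => //; case: b => //; exact: ristV.
Qed.

(* The g below is the product of the conjugates t k t^-1, one for each        *)
(* distinct translate of U.                                                   *)
Lemma spread_over_translates U (L : seq G) k :
  (forall s t, s \in L -> t \in L ->
     (forall x, U x -> act s x = act t x) \/
     (forall x x', U x -> U x' -> act s x <> act t x')) ->
  rist U k ->
  exists g, (forall t x, t \in L -> U x -> act g (act t x) = act t (act k x)) /\
    (forall z, (forall t x, t \in L -> U x -> act t x <> z) -> act g z = z).
Proof.
move=> + uk; elim: L => [|t L IH] HL; first by exists 1; split.
have [|g [gL gfix]] := IH; first by move=> s s' sL s'L; apply: HL; rewrite inE ?sL ?s'L orbT.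
(* If [t] agrees on [U] with some [s] in [L], then [g] already acts correctly on the translate by
   [t]. *)
have [[s sL ts]|nts] := pselect (exists2 s, s \in L & forall x, U x -> act t x = act s x).
  exists g; split=> [t' x|z nz]; last by apply: gfix => s' x s'L; apply: nz; rewrite inE s'L orbT.
  rewrite inE => /orP[/eqP -> Ux|]; last exact: gL.
  by rewrite !ts ?gL //; exact: rist_stable.
have disj s x x' : s \in L -> U x -> U x' -> act t x <> act s x'.
  move=> sL; have [||//|] := HL t s; rewrite ?inE ?eqxx ?sL ?orbT //; last by move=> /(_ x x').
  by move=> ts; case: nts; exists s.
have out z : (forall x, U x -> act t x <> z) -> act (t * k * t^-1) z = z.
  move=> nz; rewrite !actM uk ?actVK // => Uz; apply: (nz _ Uz); exact: actVK.
exists (t * k * t^-1 * g); split=> [t' x|z nz].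
  rewrite inE => /orP[/eqP -> Ux|t'L Ux]; rewrite actM.
    rewrite gfix; first by rewrite !actM actK.
    by move=> s x' sL Ux' /esym; exact: disj.
  rewrite gL // out // => x' Ux'; apply: disj => //; exact: rist_stable.
rewrite actM gfix; first by apply: out => x; apply: nz; rewrite mem_head.
by move=> s x sL; apply: nz; rewrite inE sL orbT.
Qed.

(** Each [kh i] is pushed to the right through the suffix value that follows it and becomes [k i];
    the constants collect on the left. *)
Lemma eval_spread (r : nat) (U : set Omega) (h kh k : 'I_r -> G)
    (l : seq ((G + 'I_r) * bool)) :
  (forall i, rist U (k i)) ->
  (forall i s x, s \in suffixes l -> U x ->
     act (kh i) (act (word_value (letter_value h) s) x) =
     act (word_value (letter_value h) s) (act (k i) x)) ->
  forall x, U x ->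
  act (word_value (letter_value (fun i => h i * kh i)) l) x =
  act (word_value (letter_value h) l) (act (word_value k (variables l)) x).
Proof.
move=> uk; elim: l => [|[[c|i] b] l IH] Hl x Ux.
- by rewrite /= !act1.
- rewrite /= !actM IH // => i s y sl; apply: Hl.
  by rewrite suffixes_cons sl orbT.
have {}IH : act (word_value (letter_value (fun i => h i * kh i)) l) x =
    act (word_value (letter_value h) l) (act (word_value k (variables l)) x).
  by apply: IH => // j s y sl; apply: Hl; rewrite suffixes_cons sl orbT.
have Uy : U (act (word_value k (variables l)) x).
  by apply: rist_stable Ux; exact: rist_word_value.
have sl : l \in suffixes ((inr i, b) :: l) by rewrite suffixes_cons suffixes_self orbT.
case: b Hl sl => Hl sl /=; rewrite [LHS]actM IH; last by rewrite actM Hl // !actM.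
(* For an inverse letter the intertwining hypothesis is used at the whole word rather than at its
   tail, at a point moved by the inverse of [k i]. *)
apply: (@act_inj (h i * kh i)); rewrite actVK !actM.
have Uy' := rist_stable (ristV (uk i)) Uy.
have := Hl i _ _ (suffixes_self _) Uy'.
by rewrite /= !actM actVK => ->; rewrite actVK.
Qed.

(** * Separating images by the Hausdorff property *)

Section Hausdorff.
Hypothesis hausdorff_Omega : hausdorff_space Omega.
Hypothesis act_homeo : acts_by_homeomorphisms act.

Lemma act_continuous g : continuous (act g).
Proof. by have [? []] := act_homeo g. Qed.

Lemma separate_images s t y : act s y <> act t y ->
  exists V, [/\ open V, V y & forall x x', V x -> V x' -> act s x <> act t x'].
Proof.
move=> /eqP; move: hausdorff_Omega; rewrite open_hausdorff => hO /hO.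
case=> -[A B] /= [/set_mem Ay /set_mem By] [oA oB /eqP AB].
exists (act s @^-1` A `&` act t @^-1` B); split=> //.
- by apply: openI; apply: open_comp => // ? _; exact: act_continuous.
- move=> x x' [Ax _] [_ Bx'] e; have : (A `&` B) (act s x) by split=> //; rewrite e.
  by rewrite AB.
Qed.

Lemma separate_all_images (L : seq G) y : exists V, [/\ open V, V y &
  forall s t, s \in L -> t \in L -> act s y <> act t y ->
  forall x x', V x -> V x' -> act s x <> act t x'].
Proof.
pose P (a : G * G) (V : set Omega) := act a.1 y <> act a.2 y ->
  forall x x', V x -> V x' -> act a.1 x <> act a.2 x'.
have [||V [oV Vy HV]] := @locally_forall _ _ P [seq (s, t) | s <- L, t <- L] y.
- by move=> a U V VU PU ne x x' /VU Ux /VU Ux'; exact: PU.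
- move=> [s t] _; have [e|ne] := pselect (act s y = act t y).
    by exists setT; split=> //; exact: openT.
  by have [V [oV Vy HV]] := separate_images ne; exists V; split=> // _.
- exists V; split=> // s t sL tL; apply: (HV (s, t)); exact: allpairs_f.
Qed.

(** For each pair, either the two elements agree on the current open set, or they differ at some
    point, near which their images can be separated. *)
Lemma equal_or_disjoint_translates (L : seq G) U : open U -> U !=set0 ->
  exists V, [/\ open V, V !=set0, V `<=` U &
  forall s t, s \in L -> t \in L ->
     (forall x, V x -> act s x = act t x) \/
     (forall x x', V x -> V x' -> act s x <> act t x')].
Proof.
move=> oU U0.
pose P (a : G * G) (V : set Omega) := (forall x, V x -> act a.1 x = act a.2 x) \/
     (forall x x', V x -> V x' -> act a.1 x <> act a.2 x').
have [||||V [oV Vy VU HV]] := @densely_forall _ _ P [seq (s, t) | s <- L, t <- L] U => //.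
- move=> a {oU U0} U V VU [PU|PU]; [left=> x /VU; exact: PU|right=> x x' /VU Ux /VU; exact: PU].
- move=> [s t] {oU U0} U oU [z Uz].
  have [e|/existsNP[y /not_implyP[Uy ne]]] := pselect (forall x, U x -> act s x = act t x).
    by exists U; split=> //; [exists z|left].
  have [V [oV Vy HV]] := separate_images ne.
  exists (U `&` V); split=> //; [exact: openI|by exists y|right=> x x' [_ Vx] [_ Vx']; exact: HV].
- exists V; split=> // s t sL tL; apply: (HV (s, t)); exact: allpairs_f.
Qed.

(** * Rigid stabilisers satisfy no law, and the perturbation argument *)

Hypothesis act_faithful : faithful_action act.
Hypothesis act_micro_supported : micro_supported act.

(** Otherwise each element of the rigid stabiliser would fix every point and be trivial by
    faithfulness, against micro-support. *)
Lemma rist_moves U : open U -> U !=set0 ->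
  exists g y, [/\ rist U g, U y & act g y <> y].
Proof.
move=> oU U0; apply: contrapT => H; apply: (act_micro_supported oU U0).
apply/seteqP; split=> [g ug|_ -> x _]; last exact: act1.
apply: act_faithful => x; apply: contrapT => ne; apply: H; exists g, x; split=> //.
by apply: contrapT => /ug.
Qed.

(** A point of [U] moved within [U] yields two points of [U], so deleting the closed set {b} leaves
    a non-empty open set. *)
Lemma avoid_point (b : Omega) U : open U -> U !=set0 ->
  exists V, [/\ open V, V !=set0, V `<=` U & ~ V b].
Proof.
move=> oU U0; have [g [y [ug Uy ne]]] := rist_moves oU U0.
have [z Uz zb] : exists2 z, U z & z <> b.
  have [e|] := pselect (y = b); last by exists y.
  by exists (act g y); [exact: rist_stable|rewrite -e].
exists (U `&` ~` [set b]); split=> [||? []//|[_] /(_ erefl)//]; last by exists z.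
apply: openI => //; apply: closed_openC; apply: accessible_closed_set1.
exact: hausdorff_accessible.
Qed.

(** By induction: some [g] maps a smaller open set off itself. The remaining elements are found in
    the rigid stabiliser of that set and keep [z] inside it, while [g] moves [z] out. *)
Lemma many_images n U : open U -> U !=set0 ->
  exists y (L : seq G), [/\ U y, size L = n, forall g, g \in L -> rist U g &
    uniq [seq act g y | g <- L]].
Proof.
elim: n U => [|n IH] U oU U0; first by case: U0 => y Uy; exists y, [::].
have [g [y [ug Uy ne]]] := rist_moves oU U0.
rewrite -[y in RHS]act1 in ne.
have [V [oV Vy HV]] := separate_images ne.
have [||z [L [[Uz Vz] sL rL uL]]] := IH (U `&` V); [exact: openI|by exists y|].
exists z, (g :: L); split=> //; first by rewrite /= sL.
- move=> g'; rewrite inE => /orP[/eqP ->//|/rL]; exact: ristS.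
- rewrite /= uL andbT; apply/negP => /mapP[g' g'L e].
  apply: (HV z (act g' z)) => //; last by rewrite act1.
  by case: (rist_stable (rL _ g'L) (conj Uz Vz)).
Qed.

(* A new letter a is replaced by h a, for some h supported near the last      *)
(* point and moving it off the trajectory: v being reduced, the earlier steps *)
(* with the same letter or its inverse are not affected.                      *)
Lemma distinct_trajectory (X : eqType) (v : seq (X * bool)) U :
  reduced v -> open U -> U !=set0 ->
  exists (k : X -> G) y, [/\ forall i, rist U (k i), U y &
    {in suffixes v &, injective (fun s => act (word_value k s) y)}].
Proof.
move=> + oU U0; elim: v => [_|[i b] v IH /= /andP[av /IH [k [y [uk Uy inj]]]]].
  case: U0 => y Uy; exists (fun=> 1), y; split=> // [_ x _|s t]; first exact: act1.
  by rewrite !inE => /eqP -> /eqP ->.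
pose val := word_value k; pose a := (i, b); pose f := val (a :: v).
have val_in s x : U x -> U (act (val s) x).
  by move=> Ux; apply: rist_stable Ux; exact: rist_word_value.
have [V0 [oV0 V0y HV0]] := separate_all_images (map val (suffixes (a :: v))) y.
pose V := V0 `&` U.
have HV s t x x' : s \in suffixes (a :: v) -> t \in suffixes (a :: v) ->
    act (val s) y <> act (val t) y -> V x -> V x' -> act (val s) x <> act (val t) x'.
  by move=> sv tv ne [Vx _] [Vx' _]; apply: HV0 => //; exact: map_f.
have tl s : s \in suffixes v -> s \in suffixes (a :: v).
  by move=> sv; rewrite suffixes_cons sv orbT.
pose W := act f^-1 @^-1` V.
have oW : open W by apply: open_comp (openI oV0 oU) => ? _; exact: act_continuous.
have W0 : W !=set0 by exists (act f y); rewrite /W /= actK.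
(* One more image than there are points on the trajectory of [v], so that by pigeonhole some [h] in
   [L] moves [z] off it. *)
have [z [L [Wz sL rL uL]]] := many_images (size (suffixes v)).+1 oW W0.
pose x := act f^-1 z; have Vx : V x by [].
have fx : act f x = z by exact: actVK.
have WU : W `<=` U.
  by move=> p Wp; rewrite -[p](actVK f); apply: val_in; case: Wp.
have [h hL hz] : exists2 h, h \in L & act h z \notin [seq act (val s) x | s <- suffixes v].
  apply: contrapT => H.
  have : {subset [seq act g z | g <- L] <= [seq act (val s) x | s <- suffixes v]}.
    by move=> _ /mapP[g gL ->]; apply/negPn/negP => gz; apply: H; exists g.
  by move=> /(uniq_leq_size uL); rewrite !size_map sL ltnn.
have uh := rL h hL.
(* For either sign [b], the letter [a] now acts as before followed by [h]. *)
pose k' j := if j == i then (if b then k i * h^-1 else h * k i) else k j.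
have notW s : s \in suffixes v -> act (val s) y <> act f y -> ~ W (act (val s) x).
  move=> sv ne Ws; apply: (HV s (a :: v) x (act f^-1 (act (val s) x))) => //.
  - exact: tl.
  - exact: suffixes_self.
  - by rewrite actVK.
have same s : s \in suffixes v -> act (word_value k' s) x = act (val s) x.
  elim: s => [|[j c] s IHs] // sv; have sv' := suffixes_tail sv.
  rewrite /= !actM IHs //; rewrite /k'; move: sv; have [-> sv|//] := eqVneq j i.
  have uhW q : ~ W q -> act h q = q /\ act h^-1 q = q.
    by move=> nWq; split; [exact: uh|exact: (ristV uh)].
  have [bc|bc] := eqVneq c b.
    (* The same letter as [a]: [h] acts after it. If the point reached from [y] were [act f y],
       cancelling the letter would give s = v by injectivity, against the lengths. *)
    rewrite bc in sv *.
    have /notW -/(_ sv)/uhW[+ _] : act (val ((i, b) :: s)) y <> act f y.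
      rewrite /f /val /= !actM => /act_inj e.
      have sE := inj _ _ sv' (suffixes_self v) e.
      by move: sv; rewrite sE (negPf (cons_notin_suffixes _ _)).
    by rewrite /val /= actM; case: (b) => /=; rewrite ?invgM ?invgK !actM.
  (* The inverse of [a]: the inverse of [h] acts before it. If [act (val s) y] were [act f y],
     injectivity would make [v] begin with the inverse of [a], which reducedness forbids. *)
  have cb : c = ~~ b by case: (c) (b) bc => [] [].
  have /notW -/(_ sv')/uhW[e e'] : act (val s) y <> act f y.
    move=> e; move: av; suff : act (val v) y = act (val ((i, c) :: s)) y.
      by move/(inj _ _ (suffixes_self v) sv) => ->; rewrite cb /= eqxx.
    rewrite /val /= actM [act (word_value k s) y]e /f /val cb /= actM.
    by case: (b); rewrite /= ?actK ?actVK.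
  by rewrite cb; case: (b) => /=; rewrite ?invgM !actM ?e ?e'.
exists k', x; split=> [j|//|].
- rewrite /k'; case: eqP => // _; have uhU := ristS WU uh.
  by case: (b); [apply: ristM => //; exact: ristV|exact: ristM].
- by case: Vx.
have new : act (word_value k' (a :: v)) x = act h z.
  rewrite -fx /f /val /= !actM same ?suffixes_self // /k' eqxx.
  by case: (b) => /=; rewrite ?invgM ?invgK actM.
have old s : s \in suffixes v -> act (word_value k' (a :: v)) x <> act (word_value k' s) x.
  move=> sv; rewrite new same // => e; move: hz; rewrite e.
  by rewrite (map_f (fun s => act (val s) x)).
move=> s t; rewrite !suffixes_cons.
case/orP=> [/eqP ->|sv]; case/orP=> [/eqP ->|tv] //; first by move/old => /(_ tv).
  by move=> /esym/old => /(_ sv).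
rewrite !same // => e; apply: inj => //; apply: contrapT => ne.
exact: (HV s t x x (tl _ sv) (tl _ tv) ne Vx Vx e).
Qed.

(** The two ends of an injective trajectory, given by the suffixes [v] and [[::]], are distinct. *)
Lemma rist_no_law (X : eqType) (v : seq (X * bool)) U :
  reduced v -> v <> [::] -> open U -> U !=set0 ->
  exists (k : X -> G) y, [/\ forall i, rist U (k i), U y & act (word_value k v) y <> y].
Proof.
move=> rv v0 oU U0; have [k [y [uk Uy inj]]] := distinct_trajectory rv oU U0.
exists k, y; split=> // e; apply: v0; apply: inj; rewrite ?suffixes_self ?nil_suffixes //.
by rewrite e /= act1.
Qed.

Lemma regular_word_nontrivial_value r (w : const_word G r) (h : 'I_r -> G) (B : seq Omega) :
  [set: Omega] !=set0 -> regular w ->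
  exists g : 'I_r -> G,
    (forall i b, b \in B -> act (g i) b = act (h i) b) /\ word_eval w g <> 1.
Proof.
move=> Omega0 rw; have [wh|] := pselect (word_eval w h = 1); last by exists h.
have [l [el rl]] := const_word_spelling w.
have [v rv wv] := free_group_reduced (word_rk w).
have v0 : v <> [::] by move=> e; apply: rw; rewrite /singular wv e.
pose L := [seq word_value (letter_value h) s | s <- suffixes l].
have [V [oV V0 _ HV]] := equal_or_disjoint_translates L openT Omega0.
(* Avoiding these points keeps [B] out of every translate of [U], so the spread elements will fix
   [B]. *)
have [|U [oU U0 UV HU]] := @densely_forall _ _ (fun p U => ~ U p)
    [seq act t^-1 b | t <- L, b <- B] V (fun _ _ _ h h' => h' \o h _) _ oV V0.
  by move=> b U oU U0; exact: avoid_point.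
have [k [y [uk Uy ky]]] := rist_no_law rv v0 oU U0.
have spread i := @spread_over_translates U L (k i) _ (uk i).
have /choice[kh khP] : forall i, exists g,
    (forall t x, t \in L -> U x -> act g (act t x) = act t (act (k i) x)) /\
    (forall z, (forall t x, t \in L -> U x -> act t x <> z) -> act g z = z).
  move=> i; apply: spread => s t sL tL.
  have [e|ne] := HV s t sL tL; [by left=> x /UV; exact: e|right=> x x' /UV Vx /UV; exact: ne].
exists (fun i => h i * kh i); split=> [i b bB|].
  rewrite actM (khP i).2 // => t x tL Ux tx; apply: (HU (act t^-1 b)); first exact: allpairs_f.
  by rewrite -tx actK.
rewrite el => e1; apply: ky.
have := eval_spread uk _ Uy; move=> /(_ h kh l).
(* Both words spell the rank of [w], so they have the same value at [k]. *)
have -> : word_value k (variables l) = word_value k v.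
  apply: (@word_value_cong _ _ _ (@no_relation 'I_r)) => //.
  by apply/presented_classP; rewrite -rl -wv.
rewrite e1 -el wh !act1 => <- // i s x sl Ux.
by apply: (khP i).1 => //; exact: map_f.
Qed.
End Hausdorff.
End Action.

(** * Neighbourhoods in the product of pointwise convergence topologies *)

Lemma agree_on_finite_nbhs (G : groupType) (Omega : choiceType) (act : G -> Omega -> Omega)
    (r : nat) (O : set (prod_topology (fun _ : 'I_r => ptwise_group act))) h :
  open O -> O h ->
  exists B : seq Omega, forall g : 'I_r -> G,
    (forall i b, b \in B -> act (g i) b = act (h i) b) -> O g.
Proof.
move=> oO Oh.
pose F : set_system (forall _ : 'I_r, ptwise_group act) := [set A | exists B : seq Omega,
  forall g : 'I_r -> G, (forall i b, b \in B -> act (g i) b = act (h i) b) -> A g].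
have FF : Filter F.
  split=> [|A A' [B HA] [B' HA']|A A' AA' [B HA]].
  - by exists [::].
  - exists (B ++ B') => g Hg; split; [apply: HA|apply: HA'] => i b bB.
      by apply: Hg; rewrite mem_cat bB.
    by apply: Hg; rewrite mem_cat bB orbT.
  - by exists B => g /HA; exact: AA'.
suff /(_ O) : F --> (h : prod_topology (fun _ : 'I_r => ptwise_group act)).
  by apply; exact: open_nbhs_nbhs.
apply/cvg_sup => i; apply/cvg_image.
  by apply/seteqP; split=> // y _; exists (fun=> y).
move=> A; rewrite nbhsE => -[A' [oA' A'h] A'A].
have [n [b Hb]] : exists n (b : n.-tuple Omega), [set k | map_tuple (act k) b = map_tuple (act (h i)) b] `<=` A'.
  (* A basic set containing [h i] prescribes exactly the values of [h i] on its tuple [b]. *)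
  case: oA' A'h => D sD <- [C DC Ch]; have [n [b [b' Cb]]] := sD _ DC.
  exists n, b => k /= kb; exists C => //.
  by move: Ch; rewrite /= Cb /= => <-.
exists [set g | A (g i)]; last first.
  by apply/seteqP; split=> [_ [g Ag <-]//|k Ak]; exists (fun=> k).
exists b => g Hg; apply: A'A; apply: Hb; apply: val_inj => /=.
by apply/eq_in_map => x; exact: Hg.
Qed.

Theorem theorem2 (G : groupType) (Omega : topologicalType)
    (act : G -> Omega -> Omega)
    (infinite_Omega : infinite_set [set: Omega])
    (hausdorff_Omega : hausdorff_space Omega)
    (act_action : is_action act)
    (act_homeo : acts_by_homeomorphisms act)
    (act_faithful : faithful_action act)
    (act_micro_supported : micro_supported act)
    (r : nat) (r_ge1 : (1 <= r)%N) :
  (forall w : const_word G r, regular w ->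
     dense [set g : prod_topology (fun _ : 'I_r => ptwise_group act)
             | word_eval w g <> 1]) /\
  (forall w : const_word G r, mixed_identity w -> singular w).
Proof.
have Omega0 : [set: Omega] !=set0.
  apply/set0P/eqP => e; apply: infinite_Omega; rewrite e; exact: finite_set0.
have main (w : const_word G r) h B (rw : regular w) :=
  regular_word_nontrivial_value act_action hausdorff_Omega act_homeo act_faithful
    act_micro_supported h B Omega0 rw.
split=> [w rw O [h Oh] oO|w mw].
  have [B HB] := agree_on_finite_nbhs oO Oh.
  by have [g [gB gw]] := main w h B rw; exists g; split=> //; exact: HB.
apply: contrapT => rw.
by have [g [_]] := main w (fun=> 1) [::] rw; exact.
Qed.
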